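(* For the annulus with $n\ge1$ marked points on one of its boundary components, the set of geodesic functions $G_{ij}$, $i,j=1,\dots,n$, is Poisson closed, i.e. the Poisson bracket of any two of these functions is a polynomial in the functions $G_{kl}$, $k,l=1,\dots,n$.
   Context: The spine is a ring of inner edges $Y_1,\dots,Y_n$ (indices mod $n$) with three-valent vertices $v_1,\dots,v_n$, where $v_i$ is incident to $Y_{i-1}$, $Y_i$ and to a pending edge $Z_i$ ending at a one-valent (pending) vertex; all pending edges lie on the same side of the ring. Edge labels also denote real coordinates. The Poisson bracket is $$\sum_{i=1}^n\left(\frac{\partial}{\partial Y_{i-1}}\wedge\frac{\partial}{\partial Z_i}+\frac{\partial}{\partial Z_i}\wedge\frac{\partial}{\partial Y_i}+\frac{\partial}{\partial Y_i}\wedge\frac{\partial}{\partial Y_{i-1}}\right).$$ Turns: at $v_i$ one turns left going $Y_{i-1}\to Z_i$, $Z_i\to Y_i$, $Y_i\to Y_{i-1}$ and right in the reverse directions. Put $$X_Z=\begin{pmatrix}0&-e^{Z/2}\\ e^{-Z/2}&0\end{pmatrix},\quad R=\begin{pmatrix}1&1\\-1&0\end{pmatrix},\quad L=\begin{pmatrix}0&1\\-1&-1\end{pmatrix},\quad F=\begin{pmatrix}0&1\\-1&0\end{pmatrix}.$$ For a closed path, the geodesic function is the trace of the product (written from right to left along the path) of $X_Y$ for each passage of an inner edge $Y$, $X_ZFX_Z$ for each visit to a pending edge $Z$ (the path is inverted at the pending vertex and returns), and $L$ or $R$ for each left or right turn. For $i\ne j$, $G_{ij}$ is the geodesic function of the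 closed path that starts at the pending edge $Z_i$, goes along $Y_i,Y_{i+1},\dots,Y_{j-1}$ (indices mod $n$) to the pending edge $Z_j$, is inverted there, and returns along $Y_{j-1},\dots,Y_i$ to $Z_i$, where it is inverted. $G_{ii}$ is the geodesic function of the closed path that starts at $Z_i$, goes once around the ring along $Y_i,Y_{i+1},\dots,Y_{i-1}$ and returns to $Z_i$, where it is inverted. The order of the indices thus indicates the direction of encompassing the second boundary component (the hole). *)

(* Defs.v *)
(* mpoly is required without Import because its notations clash with those of
   MathComp-Analysis. *)
From mathcomp Require Import all_boot all_order all_algebra.
From mathcomp Require Import all_classical all_reals all_analysis.
From mathcomp Require mpoly.

Set Implicit Arguments.
Unset Strict Implicit.
Unset Printing Implicit Defensive.

Import Order.TTheory GRing.Theory Num.Theory.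
Import numFieldNormedType.Exports.
Local Open Scope ring_scope.

(* The indices 1, ..., n modulo n are the elements 0, ..., n - 1 of 'I_n, with
   cyclic successor [ordS] and predecessor [ord_pred]. *)

Section Coordinates.
Variables (R : realType) (n : nat).

(* (Y_1, ..., Y_n) and (Z_1, ..., Z_n) *)
Definition coords : Type := ('rV[R]_n * 'rV[R]_n)%type.

Definition coordY (p : coords) (i : 'I_n) : R := p.1 0 i.
Definition coordZ (p : coords) (i : 'I_n) : R := p.2 0 i.

Definition dY (i : 'I_n) (f : coords -> R) (p : coords) : R :=
  'D_(delta_mx 0 i, 0) (f : 'rV[R]_n * 'rV[R]_n -> R^o) p.
Definition dZ (i : 'I_n) (f : coords -> R) (p : coords) : R :=
  'D_(0, delta_mx 0 i) (f : 'rV[R]_n * 'rV[R]_n -> R^o) p.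

Definition wedge (D1 D2 : (coords -> R) -> coords -> R)
    (f g : coords -> R) (p : coords) : R :=
  D1 f p * D2 g p - D2 f p * D1 g p.

Definition poisson_bracket (f g : coords -> R) (p : coords) : R :=
  \sum_(i < n) (wedge (dY (ord_pred i)) (dZ i) f g p
              + wedge (dZ i) (dY i) f g p
              + wedge (dY i) (dY (ord_pred i)) f g p).

End Coordinates.

Section Matrices.
Variable R : realType.

Definition mx22 (a b c d : R) : 'M[R]_2 :=
  \matrix_(i, j) if i == 0 then (if j == 0 then a else b)
                 else (if j == 0 then c else d).

Definition edgeX (z : R) : 'M[R]_2 :=
  mx22 0 (- expR (z / 2)) (expR (- (z / 2))) 0.
Definition matR : 'M[R]_2 := mx22 1 1 (-1) 0.
Definition matL : 'M[R]_2 := mx22 0 1 (-1) (-1).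
Definition matF : 'M[R]_2 := mx22 0 1 (-1) 0.

End Matrices.

(* The three half-edges at the vertex v_i: [In] is the end of Y_{i-1}, [Pend]
   is Z_i and [Out] is the beginning of Y_i.  Working with half-edges rather
   than edges keeps the two ends of the loop Y_1 apart when n = 1. *)
Variant half_edge := In | Pend | Out.

(* The value for a = b is irrelevant: a path is only inverted at a pending
   vertex, and that is part of the matrix of the visit. *)
Definition turn (R : realType) (a b : half_edge) : 'M[R]_2 :=
  match a, b with
  | In, Pend | Pend, Out | Out, In => matL R
  | Pend, In | Out, Pend | In, Out => matR R
  | _, _ => 1
  end.

(* [Fwd i] passes Y_i from v_i to v_{i+1}, [Bwd i] passes Y_i from v_{i+1} to
   v_i, and [Visit i] goes from v_i along Z_i to the pending vertex, is inverted
   there and returns to v_i. *)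
Variant step (n : nat) := Fwd of 'I_n | Bwd of 'I_n | Visit of 'I_n.

Definition departure n (s : step n) : half_edge :=
  match s with Fwd _ => Out | Bwd _ => In | Visit _ => Pend end.

Definition arrival n (s : step n) : half_edge :=
  match s with Fwd _ => In | Bwd _ => Out | Visit _ => Pend end.

Definition step_mx (R : realType) n (p : coords R n) (s : step n) : 'M[R]_2 :=
  match s with
  | Fwd i | Bwd i => edgeX (coordY p i)
  | Visit i => edgeX (coordZ p i) *m matF R *m edgeX (coordZ p i)
  end.

(* [path_mx p c s] is the product, from right to left, along the steps of [s],
   each one followed by the turn towards the next step; the step after the last
   one is [c]. *)
Fixpoint path_mx (R : realType) n (p : coords R n) (c : step n)
    (s : seq (step n)) : 'M[R]_2 :=
  if s is x :: s' then
    path_mx p c s' *m (turn R (arrival x) (departure (head c s'))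
                       *m step_mx p x)
  else 1%:M.

(* The closed path is given by its first step [c] and the remaining ones. *)
Definition geodesic_function (R : realType) n (c : step n) (s : seq (step n))
    (p : coords R n) : R :=
  \tr (path_mx p c (c :: s)).

(* i, i+1, ..., j-1 modulo n; the whole ring when i = j *)
Definition ring_arc n (i j : 'I_n) : seq 'I_n :=
  traject (@ordS n) i (if i == j then n else (j + n - i) %% n)%N.

(* Only the pending edge Z_i is visited when i = j, where the path does not
   return along the ring. *)
Definition G (R : realType) n (i j : 'I_n) : coords R n -> R :=
  if i == j then
    geodesic_function (Visit i) [seq Fwd k | k <- ring_arc i i]
  else
    geodesic_function (Visit i)
      ([seq Fwd k | k <- ring_arc i j] ++ Visit j ::
       [seq Bwd k | k <- rev (ring_arc i j)]).

(* Real polynomials in the n * n variables indexed by pairs (k, l), evaluated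
   at the family a. *)
Definition pair_poly (R : realType) n : Type := mpoly.mpoly (n * n)%N R.

Definition pair_eval (R : realType) n (a : 'I_n -> 'I_n -> R)
    (P : pair_poly R n) : R :=
  mpoly.meval (fun m => mxvec (\matrix_(k, l) a k l) 0 m) P.

(* Main.v *)
Require Import Defs.
From mathcomp Require Import all_boot all_order all_algebra.
From mathcomp Require Import all_classical all_reals all_analysis.
From mathcomp Require Import ring lra.
From mathcomp Require mpoly.
Import (canonicals, coercions) mpoly.
Import Order.TTheory GRing.Theory Num.Theory.
Import numFieldNormedType.Exports.

Set Implicit Arguments.
Unset Strict Implicit.
Unset Printing Implicit Defensive.

Local Open Scope ring_scope.

(** Cut the ring open at a vertex and develop it in the upper half plane.  Since
    [matR R *m edgeX Y] is upper triangular, passing along the ring acts by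
    affine maps of the real line.  To the vertices met along the ring correspond
    half-circles standing side by side on that line, the a-th one of width
    S_a = exp (Y_0 + ... + Y_(a-1)), and the visit to the pending edge Z_a
    becomes the half-turn about a point of the a-th half-circle, of abscissa x_a
    and height t_a.  One more turn around the ring acts by z |-> lam z + mu.
    Computing traces ([G_chord], [G_loop]) shows that G_ij is

      ((x' - x)^2 + t^2 + t'^2) / (t t')

    for two such points, while G_ii is ((lam - 1) x + mu) / (t sqrt lam).  For
    positions a, c in the cut ring write U_ac for this function of the points a
    and c, V_ac for the same function of the point a and the image of the point
    c after one more turn, and g_a for the loop.  So G_ij is a U if the path
    avoids the cut, and a V_ac with c < a if it crosses it.

    The bracket is simple in these coordinates.  Up to corrections that
    scale-invariant functions do not see, {log S_a, log S_c} = -1 for a < c and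
    {log S_a, Z_c} is 1 if a = c and 0 otherwise, and log lam is a Casimir
    ([poisson_bracketE]).  Hence the brackets of the x_a, t_a and mu are
    quadratic polynomials, and they depend on the position of the vertices only
    through the sign s_ac of c - a.  The bracket of any two of U, V, g is then
    one identity between rational functions, valid for all positions at once,
    in which the signs are parameters:

      {U_ij, U_kl} = (s_ik - s_il - s_jk + s_jl) (U_ik U_jl - U_il U_jk),
      {U_ij, V_kl} = (s_ik - s_jk) (U_ik V_jl - V_il U_jk)
                     + (s_jl - s_il) (V_ki U_jl - U_il V_kj),
      {U_ij, g_k}  = (s_ik - s_jk) (U_ik g_j - U_jk g_i),
      {g_i, g_j}   = (V_ij - V_ji) / 2 + s_ij (U_ij - (V_ij + V_ji) / 2).

    Cutting at the vertex i makes G_ij a U or a g, so that, the bracket being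
    skew, these four cases suffice.  All U and g are polynomials in the G_kl,
    but V_ac is one of them only if c < a.  Otherwise
    V_ac + V_ca = (lam + 1 / lam) U_ac + 2 g_a g_c ([outer_chord_sum]) expresses
    it through these and the Casimir lam + 1 / lam.  In {U_ij, V_kl} with l < k
    the terms with this Casimir cancel because
    s_ak - s_al + s_ak s_al = 1 for every a ([order_sign_separation]). *)

(** * Polynomials in the functions G *)

Section PolynomialsInG.
Context (R : realType) (n : nat).
Implicit Types f g : coords R n -> R.

Definition poly_in_G f : Prop :=
  exists P : pair_poly R n, forall p,
    f p = pair_eval (fun r s : 'I_n => G r s p) P.

Lemma poly_in_G_ext f g : f =1 g -> poly_in_G g -> poly_in_G f.
Proof. by move=> fg [P gP]; exists P => p; rewrite fg gP. Qed.

Lemma poly_in_G_cst (c : R) : poly_in_G (fun=> c).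
Proof.
by exists (mpoly.mpolyC (n * n) c) => p; rewrite /pair_eval mpoly.mevalC.
Qed.

Lemma poly_in_G_gen (i j : 'I_n) : poly_in_G (@G R n i j).
Proof.
exists (mpoly.mpolyX R (mpoly.mnm1 (mxvec_index i j))) => p.
by rewrite /pair_eval mpoly.mevalXU mxvecE mxE.
Qed.

Lemma poly_in_G_add f g :
  poly_in_G f -> poly_in_G g -> poly_in_G (fun p => f p + g p).
Proof.
move=> [P fP] [Q gQ]; exists (P + Q) => p.
by rewrite /pair_eval mpoly.mevalD fP gQ.
Qed.

Lemma poly_in_G_mul f g :
  poly_in_G f -> poly_in_G g -> poly_in_G (fun p => f p * g p).
Proof.
move=> [P fP] [Q gQ]; exists (P * Q) => p.
by rewrite /pair_eval mpoly.mevalM fP gQ.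
Qed.

Lemma poly_in_G_opp f : poly_in_G f -> poly_in_G (fun p => - f p).
Proof.
move=> hf; apply: (poly_in_G_ext (fun p => esym (mulN1r (f p)))).
exact: poly_in_G_mul (poly_in_G_cst _) hf.
Qed.

Lemma poly_in_G_sub f g :
  poly_in_G f -> poly_in_G g -> poly_in_G (fun p => f p - g p).
Proof. by move=> hf hg; exact: poly_in_G_add hf (poly_in_G_opp hg). Qed.

End PolynomialsInG.

(** * The geodesic functions as hyperbolic distances *)

Section MatrixAlgebra.
Context (R : realType).
Implicit Types a b c d : R.

Lemma mx22M a b c d a' b' c' d' :
  mx22 a b c d *m mx22 a' b' c' d' =
  mx22 (a * a' + b * c') (a * b' + b * d') (c * a' + d * c') (c * b' + d * d').
Proof.
apply/matrixP => i j; rewrite !mxE !big_ord_recl big_ord0 !mxE /= addr0.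
by case: (i == 0); case: (j == 0).
Qed.

Lemma mxtrace22 a b c d : \tr (mx22 a b c d) = a + d.
Proof. by rewrite /mxtrace !big_ord_recl big_ord0 !mxE /= addr0. Qed.

Lemma mx22_eq a b c d a' b' c' d' :
  a = a' -> b = b' -> c = c' -> d = d' -> mx22 a b c d = mx22 a' b' c' d'.
Proof. by move=> -> -> -> ->. Qed.

Lemma visit_mxE (z : R) :
  edgeX z *m matF R *m edgeX z = mx22 0 (- expR z) (expR z)^-1 0.
Proof.
have zE : expR z = expR (z / 2) ^+ 2.
  by rewrite -expRM_natl mulrC divfK // pnatr_eq0.
rewrite /edgeX /matF !mx22M expRN zE; have := expR_gt0 (z / 2).
by move: (expR _) => y y0; apply: mx22_eq; field; rewrite ?gt_eqF.
Qed.

End MatrixAlgebra.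

(** For the half-turns about the points (x, t) and (x', t') of the upper half
    plane, this is minus the trace of their product, that is, twice the
    hyperbolic cosine of the distance of the two points. *)
Definition chord (R : realType) (x t x' t' : R) : R :=
  ((x' - x) ^+ 2 + t ^+ 2 + t' ^+ 2) / (t * t').

Section Window.
Context (R : realType) (n : nat) (b : 'I_n).
Implicit Types p : coords R n.

(** Positions are natural numbers, counted from the vertex [b] where the ring is
    cut; positions that differ by [n] name the same vertex, reached after
    another turn around the ring. *)
Definition vtx (a : nat) : 'I_n := iter a (@ordS n) b.

Lemma val_vtx a : vtx a = ((b + a) %% n)%N :> nat.
Proof.
elim: a => [|a IH]; first by rewrite addn0 modn_small.
by rewrite /vtx iterS /= -/(vtx a) IH -addn1 modnDml addn1 addnS.
Qed.

Lemma vtxDn a : vtx (a + n) = vtx a.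
Proof. by apply: val_inj; rewrite /= !val_vtx addnA modnDr. Qed.

Lemma vtx_eq a a' : (vtx a == vtx a') = (a == a' %[mod n]).
Proof. by rewrite -val_eqE /= !val_vtx eqn_modDl. Qed.

Lemma vtx_surj (k : 'I_n) : exists2 a, (a < n)%N & k = vtx a.
Proof.
have n0 : (0 < n)%N by case: n k => // -[].
exists ((k + n - b) %% n)%N; first exact: ltn_pmod.
apply: val_inj; rewrite /= val_vtx modnDmr subnKC ?modnDr ?modn_small //.
by rewrite ltnW // (leq_trans (ltn_ord b)) // leq_addl.
Qed.

Lemma vtx_dist a m : (0 < m)%N -> (m < n)%N ->
  ((vtx (a + m) + n - vtx a) %% n = m)%N.
Proof.
move=> m0 mn; apply/eqP; rewrite -[X in _ == X](modn_small mn).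
have ltv : (vtx a <= vtx (a + m) + n)%N.
  by rewrite ltnW // (leq_trans (ltn_ord _)) // leq_addl.
rewrite -(eqn_modDr (vtx a)) subnK // modnDr !val_vtx modn_mod.
by rewrite modnDmr addnA [(m + _)%N]addnC.
Qed.

Lemma iter_vtx a m : iter m (@ordS n) (vtx a) = vtx (a + m).
Proof. by rewrite /vtx -iterD addnC. Qed.

(** The a-th half-circle has its left end at [foot a] and its right end at
    [foot a.+1]; the half-turn at v_a has its centre on it, at a place that
    depends on Z_a only. The width is introduced through its square root because
    the matrices contain exp (Y / 2). *)
Definition root_width p a : R :=
  expR ((\sum_(k < a) coordY p (vtx k)) / 2).
Definition width p a : R := root_width p a ^+ 2.
Definition foot p a : R := \sum_(k < a) width p k.
Definition weight p a : R := expR (coordZ p (vtx a)).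
Definition absc p a : R :=
  foot p a + width p a * (weight p a ^+ 2 / (1 + weight p a ^+ 2)).
Definition height p a : R :=
  width p a * (weight p a / (1 + weight p a ^+ 2)).

Lemma root_width_gt0 p a : 0 < root_width p a. Proof. exact: expR_gt0. Qed.
Lemma weight_gt0 p a : 0 < weight p a. Proof. exact: expR_gt0. Qed.

Lemma root_widthS p a :
  root_width p a.+1 = root_width p a * expR (coordY p (vtx a) / 2).
Proof. by rewrite /root_width big_ord_recr /= mulrDl expRD. Qed.

Lemma footS p a : foot p a.+1 = foot p a + width p a.
Proof. by rewrite /foot big_ord_recr. Qed.

Lemma edgeYE p a : edgeX (coordY p (vtx a)) =
  mx22 0 (- (root_width p a.+1 / root_width p a))
       (root_width p a / root_width p a.+1) 0.
Proof.
rewrite /edgeX root_widthS expRN; have := root_width_gt0 p a.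
have := expR_gt0 (coordY p (vtx a) / 2).
move: (expR _) (root_width p a) => y h y0 h0.
by apply: mx22_eq => //; field; rewrite ?gt_eqF.
Qed.

Lemma path_mx_cons p c (u : step n) (us : seq (step n)) :
  path_mx p c (u :: us) = path_mx p c us *m
    (turn R (arrival u) (departure (head c us)) *m step_mx p u).
Proof. by []. Qed.

Let arc a m : seq 'I_n := traject (@ordS n) (vtx a) m.

Let shift p a m : R :=
  (foot p (a + m).+1 - foot p a.+1) / (root_width p a * root_width p (a + m)).

(** The turn that follows the last inner edge belongs to the next step, so the
    product falls short of a product of upper triangular matrices
    [matR R *m edgeX Y] by one factor; that factor is [- matL R], the inverse
    of [matR R]. *)
Lemma path_forward p c a m (rest : seq (step n)) :
  path_mx p c ([seq Fwd k | k <- arc a m.+1] ++ rest) =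
  path_mx p c rest *m turn R In (departure (head c rest)) *m
  mx22 0 (- (root_width p (a + m.+1) / root_width p a))
       (root_width p a / root_width p (a + m.+1))
       (root_width p (a + m.+1) / root_width p a - shift p a m.+1).
Proof.
rewrite /arc; elim: m a => [|m IH] a.
  rewrite /= edgeYE mulmxA addn1 /shift addn1 footS /width; congr (_ *m _).
  have := root_width_gt0 p a; have := root_width_gt0 p a.+1.
  move: (root_width p a) (root_width p a.+1) (foot _ _) => h h' f h0 h'0.
  by apply: mx22_eq; field; rewrite ?gt_eqF.
rewrite trajectS map_cons cat_cons.
rewrite path_mx_cons -[ordS (vtx a)]/(vtx a.+1) [departure _]/= [turn _ _ _]/=.
rewrite [step_mx _ _]/= IH -mulmxA; congr (_ *m _).
rewrite edgeYE /matR !mx22M /shift addSnnS.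
have := root_width_gt0 p a; have := root_width_gt0 p a.+1.
have := root_width_gt0 p (a + m.+2).
rewrite !footS /width.
move: (root_width p a) (root_width p a.+1) (root_width p (a + m.+2)).
move: (foot _ _) (foot _ _) => f1 f2 h h' h'' h0 h'0 h''0.
by apply: mx22_eq; field; rewrite ?gt_eqF.
Qed.

(** Since [matL R] is minus the inverse of [matR R], returning along the ring
    inverts the upper triangular product of the way out. *)
Lemma path_backward p i a m :
  path_mx p (Visit i) [seq Bwd k | k <- rev (arc a m.+1)] =
  let h := root_width p (a + m.+1) / root_width p a in
  mx22 (h^-1 + shift p a m.+1 - h) (- h) (h - shift p a m.+1) h.
Proof.
rewrite /arc; elim: m => [|m IH].
  rewrite /= edgeYE mul1mx addn1 /matR /shift addn1 mx22M /= footS /width.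
  have := root_width_gt0 p a; have := root_width_gt0 p a.+1.
  move: (root_width p a) (root_width p a.+1) (foot _ _) => h h' f h0 h'0.
  by apply: mx22_eq; field; rewrite ?gt_eqF.
have dep : departure (head (Visit i)
    [seq Bwd k | k <- rev (traject (@ordS n) (vtx a) m.+1)]) = In.
  by rewrite trajectSr rev_rcons.
rewrite trajectSr rev_rcons map_cons iter_vtx [LHS]/= dep.
rewrite IH /= edgeYE /matL !mx22M /shift -addnS !addnS.
have := root_width_gt0 p a; have := root_width_gt0 p (a + m).+1.
have := root_width_gt0 p (a + m).+2.
rewrite !footS /width.
move: (root_width p a) (root_width p (a + m).+1) (root_width p (a + m).+2).
move: (foot _ _) (foot _ _) => f1 f2 h h' h'' h0 h'0 h''0.
by apply: mx22_eq; field; rewrite ?gt_eqF.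
Qed.

Lemma root_widthDn p a : root_width p (a + n) = root_width p n * root_width p a.
Proof.
elim: a => [|a IH]; first by rewrite {3}/root_width big_ord0 mul0r expR0 mulr1.
by rewrite addSn !root_widthS IH vtxDn mulrA.
Qed.

Lemma widthDn p a : width p (a + n) = width p n * width p a.
Proof. by rewrite /width root_widthDn exprMn. Qed.

(** One more turn around the ring acts on the line by the affine map with
    multiplier [width p n] and translation part [foot p n]. *)
Lemma footDn p a : foot p (a + n) = width p n * foot p a + foot p n.
Proof.
elim: a => [|a IH]; first by rewrite {2}/foot big_ord0 mulr0 add0r.
by rewrite addSn !footS IH widthDn mulrDr addrAC.
Qed.

Lemma weightDn p a : weight p (a + n) = weight p a.
Proof. by rewrite /weight vtxDn. Qed.

Lemma abscDn p a : absc p (a + n) = width p n * absc p a + foot p n.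
Proof.
rewrite /absc footDn widthDn weightDn.
by rewrite mulrDr -(mulrA (width p n)) addrAC.
Qed.

Lemma heightDn p a : height p (a + n) = width p n * height p a.
Proof. by rewrite /height widthDn weightDn -(mulrA (width p n)). Qed.

(** The way back inverts the upper triangular matrix M of the way out, so the
    trace is that of the half-turn at position [a] times the conjugate by M of
    the half-turn at the other end.  The positions [a + m >= n] beyond the cut
    are the images under z |-> lam z + mu. *)
Lemma G_chord p a m : (0 < m)%N -> (m < n)%N ->
  G (vtx a) (vtx (a + m)) p =
  chord (absc p a) (height p a) (absc p (a + m)) (height p (a + m)).
Proof.
move=> m0 mn.
have neq : (vtx a == vtx (a + m)) = false.
  rewrite vtx_eq -[X in X == _ %[mod _]](addn0 a) eqn_modDl mod0n modn_small //.
  by rewrite eq_sym; apply/negbTE; rewrite -lt0n.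
rewrite /G /ring_arc neq vtx_dist //; case: m m0 mn {neq} => // m _ mn.
have headF c s : departure (head c ([seq Fwd k | k <- arc a m.+1] ++ s)) = Out.
  by [].
have headB c : departure (head c [seq Bwd k | k <- rev (arc a m.+1)]) = In.
  by rewrite /arc trajectSr rev_rcons.
rewrite /geodesic_function path_mx_cons headF path_forward.
rewrite path_mx_cons headB path_backward.
rewrite /= !visit_mxE /matL /matR !mx22M mxtrace22 /shift.
rewrite /chord /absc /height !footS /width -!/(weight _ _).
have := root_width_gt0 p a; have := root_width_gt0 p (a + m.+1).
have := weight_gt0 p a; have := weight_gt0 p (a + m.+1).
move: (root_width p _) (root_width p _) (weight p _) (weight p _).
move: (foot _ _) (foot _ _) => f f' h h' w w' w'0 w0 h'0 h0.
have q0 : 1 + w ^+ 2 != 0 by rewrite gt_eqF // addr_gt0 // exprn_gt0.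
have q'0 : 1 + w' ^+ 2 != 0 by rewrite gt_eqF // addr_gt0 // exprn_gt0.
by field; rewrite ?q0 ?q'0 ?gt_eqF.
Qed.

(** Here the ring is passed only once: the trace is that of one half-turn times
    the upper triangular matrix of a full turn around the ring. *)
Lemma G_loop p a : G (vtx a) (vtx a) p =
  (absc p (a + n) - absc p a) / (height p a * root_width p n).
Proof.
rewrite /G /ring_arc eqxx /geodesic_function.
have n0 : (0 < n)%N by case: n b => // -[].
have [m mE] : exists m, n = m.+1 by exists n.-1; rewrite prednK.
have headF c : departure (head c [seq Fwd k | k <- arc a m.+1]) = Out by [].
have -> : traject (@ordS n) (vtx a) n = arc a m.+1 by rewrite /arc -mE.
rewrite path_mx_cons headF -[map _ _]cats0.
rewrite path_forward -mE /= visit_mxE mul1mx /matL !mx22M mxtrace22 /shift.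
rewrite /absc /height weightDn !footS -!/(weight _ _) !widthDn footDn.
rewrite root_widthDn /width.
have := root_width_gt0 p a; have := root_width_gt0 p n; have := weight_gt0 p a.
move: (root_width p _) (root_width p _) (weight p _).
move: (foot _ _) (foot _ _) => f f' h h' w w0 h'0 h0.
have q0 : 1 + w ^+ 2 != 0 by rewrite gt_eqF // addr_gt0 // exprn_gt0.
by field; rewrite ?q0 ?gt_eqF.
Qed.

End Window.

(** * The Poisson bracket as a skew form *)

Section SkewForm.
Context (R : realType).
Implicit Types F W : nat -> R.

Definition psum F e : R := \sum_(k < e) F k.

(** The pair [u] stands for the differential of a function: [u.1 a] is its
    derivative along log S_a and [u.2 a] that along Z_a.  The form is the
    bracket with {log S_a, Z_a} = 1 and {log S_a, log S_c} = -1 for a < c. *)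
Definition skew_form n (u v : (nat -> R) * (nat -> R)) : R :=
  \sum_(e < n) (u.1 e * v.2 e - u.2 e * v.1 e) -
  \sum_(e < n) (psum u.1 e * v.1 e - u.1 e * psum v.1 e).

Lemma psumS F e : psum F e.+1 = psum F e + F e.
Proof. by rewrite /psum big_ord_recr. Qed.

Lemma skew_formC n u v : skew_form n u v = - skew_form n v u.
Proof.
rewrite /skew_form opprB addrC -!sumrN; congr (_ + _).
  by apply: eq_bigr => e _; ring.
by apply: eq_bigr => e _; ring.
Qed.

Lemma eq_skew_form n u u' v v' :
  (forall e, (e < n)%N -> u.1 e = u'.1 e /\ u.2 e = u'.2 e) ->
  (forall e, (e < n)%N -> v.1 e = v'.1 e /\ v.2 e = v'.2 e) ->
  skew_form n u v = skew_form n u' v'.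
Proof.
have eq_psum (x y : (nat -> R) * (nat -> R)) (e : 'I_n) :
    (forall e, (e < n)%N -> x.1 e = y.1 e /\ x.2 e = y.2 e) ->
    psum x.1 e = psum y.1 e.
  move=> xy; apply: eq_bigr => k _.
  by have [] := xy k (ltn_trans (ltn_ord k) (ltn_ord e)).
move=> uu' vv'; congr (_ - _); apply: eq_bigr => e _.
  have [-> ->] := uu' e (ltn_ord e).
  by have [-> ->] := vv' e (ltn_ord e).
rewrite (eq_psum u u') // (eq_psum v v') //.
by have [-> _] := uu' e (ltn_ord e); have [-> _] := vv' e (ltn_ord e).
Qed.

Definition comb (s : seq (R * ((nat -> R) * (nat -> R)))) :
    (nat -> R) * (nat -> R) :=
  (fun e => \sum_(x <- s) x.1 * x.2.1 e, fun e => \sum_(x <- s) x.1 * x.2.2 e).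

Lemma skew_form_combl n s v :
  skew_form n (comb s) v = \sum_(x <- s) x.1 * skew_form n x.2 v.
Proof.
elim: s => [|x s IH].
  rewrite big_nil /skew_form !big1 ?subr0 // => e _ /=;
    rewrite /psum ?big_nil ?mul0r ?subr0 // big1 ?mul0r ?subrr // => k _.
  by rewrite big_nil.
rewrite big_cons -IH /skew_form mulrBr !mulr_sumr.
rewrite addrACA -opprD -!big_split /=; congr (_ - _); apply: eq_bigr => e _.
  by rewrite !big_cons; ring.
rewrite !big_cons /psum.
have -> : \sum_(k < e) \sum_(y <- x :: s) y.1 * y.2.1 k =
    x.1 * (\sum_(k < e) x.2.1 k) + \sum_(k < e) \sum_(y <- s) y.1 * y.2.1 k.
  by rewrite mulr_sumr -big_split /=; apply: eq_bigr => k _; rewrite big_cons.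
by ring.
Qed.

Lemma skew_form_comb n s s' :
  skew_form n (comb s) (comb s') =
  \sum_(x <- s) \sum_(y <- s') x.1 * y.1 * skew_form n x.2 y.2.
Proof.
rewrite skew_form_combl; apply: eq_bigr => x _.
rewrite skew_formC skew_form_combl -sumrN mulr_sumr; apply: eq_bigr => y _.
by rewrite (skew_formC n y.2); ring.
Qed.

End SkewForm.

Section BracketAsForm.
Context (R : realType) (n : nat) (b : 'I_n).
Implicit Types (f g : coords R n -> R) (p : coords R n).
Local Notation vtx := (vtx b).

(** The coordinate Y_a is the difference of log S_(a+1) and log S_a, so the
    derivative along log S_a is the derivative along Y_(a-1) minus that along
    Y_a.  This also holds cyclically, since closing up the ring only adds the
    Casimir log lam to the last Y. *)
Definition covector f p : (nat -> R) * (nat -> R) :=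
  (fun e => dY (ord_pred (vtx e)) f p - dY (vtx e) f p,
   fun e => dZ (vtx e) f p).

Lemma sum_vtx (T : 'I_n -> R) : \sum_i T i = \sum_(e < n) T (vtx e).
Proof.
have inj : injective (fun e : 'I_n => vtx e).
  move=> e e' /eqP; rewrite vtx_eq !modn_small // => /eqP.
  exact: val_inj.
by rewrite (reindex_inj inj).
Qed.

(** Partial sums of the first component telescope to [z f 0 - z f e], where
    [z f e] is the derivative along the edge before position [e]. The boundary
    terms cancel because [z f] is periodic. *)
Lemma poisson_bracketE f g p :
  poisson_bracket f g p = skew_form n (covector f p) (covector g p).
Proof.
pose z h e := dY (ord_pred (vtx e)) h p.
have zE h e : dY (ord_pred (vtx e)) h p = z h e by [].
have zS h e : dY (vtx e) h p = z h e.+1 by rewrite /z /= ordSK.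
have zn h : z h n = z h 0 by rewrite /z (vtxDn b 0 : vtx n = vtx 0).
have covE h e : (covector h p).1 e = z h e - z h e.+1.
  by rewrite /covector [LHS]/= zE zS.
clearbody z.
have psumE h e : psum (covector h p).1 e = z h 0 - z h e.
  elim: e => [|e IH]; first by rewrite /psum big_ord0 subrr.
  by rewrite psumS IH covE; move: (z h 0) (z h e) (z h e.+1) => *; ring.
rewrite /poisson_bracket sum_vtx /skew_form -sumrB.
(* The two sides differ by a telescoping sum. *)
pose H e := z g 0 * z f e - z f 0 * z g e.
apply/eqP; rewrite -subr_eq0 -sumrB; apply/eqP.
rewrite (eq_bigr (fun e : 'I_n => H e.+1 - H e)) => [|e _].
  rewrite -(big_mkord xpredT (fun e => H e.+1 - H e)) telescope_sumr //.
  by rewrite /H !zn subrr.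
rewrite !psumE !covE /wedge /H !zE !zS /=.
move: (dZ _ f p) (dZ _ g p) (z f 0) (z f e) (z f e.+1).
by move: (z g 0) (z g e) (z g e.+1); move=> *; ring.
Qed.

End BracketAsForm.

(** * Brackets of the coordinates of the half-turns *)

Section Stems.
Context (R : realType) (S : nat -> R).
Implicit Types (s v w : R) (i j n e : nat).

(** A function s (S_0 + ... + S_(i-1)) + f (S_i, Z_i) has this differential,
    with v = S_i df/dS_i and w = df/dZ_i.  The abscissae (s = 1), the heights
    (s = 0) and mu (s = 1, f = 0, i = n) are all of this kind. *)
Definition stem s v w i : (nat -> R) * (nat -> R) :=
  (fun e => s * S e * (e < i)%:R + v * (e == i)%:R,
   fun e => w * (e == i)%:R).

Lemma psum_stem s v w i e :
  psum (stem s v w i).1 e = s * psum S (minn e i) + v * (i < e)%:R.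
Proof.
elim: e => [|e IH]; first by rewrite min0n /psum !big_ord0 !mulr0 addr0.
rewrite psumS IH /=; case: (ltngtP e i) => [lt|gt|->].
- rewrite (minn_idPl lt) psumS.
  by rewrite ltnS leqNgt lt /=; ring.
- rewrite (minn_idPr (leqW (ltnW gt))).
  by rewrite ltnS (ltnW gt) /=; ring.
- rewrite (minn_idPr (leqnSn i)) ltnSn /=; ring.
Qed.

(** In the partial sums, the positions before [i] and those after it count with
    opposite signs. *)
Lemma skew_form_point n v w i (u : (nat -> R) * (nat -> R)) : (i < n)%N ->
  skew_form n (stem 0 v w i) u =
  v * (u.2 i + psum u.1 i + psum u.1 i.+1 - psum u.1 n) - w * u.1 i.
Proof.
have after m (F : nat -> R) : (i < m)%N ->
    \sum_(e < m) (i < e)%:R * F e = psum F m - psum F i.+1.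
  elim: m => // m IH; rewrite ltnS leq_eqVlt big_ord_recr /=.
  move=> /orP[/eqP <-|lt].
    rewrite ltnn mul0r addr0 subrr big1 // => e _.
    by rewrite ltnNge ltnW // mul0r.
  by rewrite IH // lt mul1r (psumS F m); ring.
have at_i m (F : nat -> R) : (i < m)%N ->
    \sum_(e < m) (val e == i)%:R * F e = F i.
  move=> lt; rewrite (bigD1 (Ordinal lt)) //= eqxx mul1r big1 ?addr0 // => e.
  by rewrite -val_eqE /= => /negbTE ->; rewrite mul0r.
move=> lt; rewrite /skew_form.
rewrite (eq_bigr (fun e : 'I_n =>
  (val e == i)%:R * (v * u.2 e - w * u.1 e))); last by move=> e _ /=; ring.
rewrite (at_i _ (fun e => v * u.2 e - w * u.1 e)) //.
rewrite [X in _ - X](eq_bigr (fun e : 'I_n => (i < e)%:R * (v * u.1 e) -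
    (val e == i)%:R * (v * psum u.1 e))); last first.
  by move=> e _; rewrite psum_stem /=; ring.
rewrite sumrB (at_i _ (fun e => v * psum u.1 e)) //.
rewrite (after _ (fun e => v * u.1 e)) //.
have psumZ m : psum (fun e => v * u.1 e) m = v * psum u.1 m.
  by rewrite /psum mulr_sumr.
by rewrite !psumZ; ring.
Qed.

(** By linearity, from the contributions of the single positions [k < i] of the
    sum and of the position [i]. *)
Lemma skew_form_stem n s v w i (u : (nat -> R) * (nat -> R)) : (i < n)%N ->
  skew_form n (stem s v w i) u =
  s * (\sum_(k < i) S k * (u.2 k + psum u.1 k + psum u.1 k.+1 - psum u.1 n)) +
  v * (u.2 i + psum u.1 i + psum u.1 i.+1 - psum u.1 n) - w * u.1 i.
Proof.
have split s' v' w' m : skew_form n (stem s' v' w' m) u =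
    skew_form n (stem s' 0 0 m) u + skew_form n (stem 0 v' w' m) u.
  rewrite -[X in _ = X + _]mul1r -[X in _ = _ + X]mul1r.
  rewrite (_ : _ + _ = \sum_(x <- [:: (1, stem s' 0 0 m); (1, stem 0 v' w' m)])
     x.1 * skew_form n x.2 u); last by rewrite !big_cons big_nil addr0.
  rewrite -skew_form_combl; apply: eq_skew_form => // e _ /=.
  by rewrite !big_cons !big_nil /=; split; ring.
have step m : skew_form n (stem s 0 0 m.+1) u =
    skew_form n (stem s (s * S m) 0 m) u.
  apply: eq_skew_form => // e _ /=; split; last by rewrite !mul0r.
  by rewrite ltnS; case: (ltngtP e m) => [_|_|->] /=; ring.
move=> lt; rewrite split (@skew_form_point n v w i) // addrA.
congr (_ + _ - _); elim: i lt => [|i IH] lt.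
  rewrite big_ord0 mulr0 (_ : stem s 0 0 0 = stem 0 0 0 0).
    by rewrite skew_form_point // !mul0r subrr.
  by congr pair; apply: funext => e /=; rewrite ?ltn0; ring.
rewrite step split IH 1?ltnW // skew_form_point 1?ltnW //.
by rewrite big_ord_recr /=; ring.
Qed.

Lemma skew_form_stem_lt n s v w i s' v' w' j : (i < j)%N -> (j <= n)%N ->
  skew_form n (stem s v w i) (stem s' v' w' j) =
  s * s' * psum S i ^+ 2 + 2 * s' * v * psum S i + s' * v * S i - w * s' * S i
  - (s * psum S i + v) * (s' * psum S j + v' * (j < n)%:R).
Proof.
move=> ij jn; rewrite skew_form_stem ?(leq_trans ij) //.
set tot := psum _ n; have totE : tot = s' * psum S j + v' * (j < n)%:R.
  by rewrite /tot psum_stem (minn_idPr jn).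
rewrite -totE.
have at_lt k : (k < j)%N ->
    ((stem s' v' w' j).2 k + psum (stem s' v' w' j).1 k +
     psum (stem s' v' w' j).1 k.+1 - tot = s' * (psum S k + psum S k.+1) - tot).
  move=> kj; rewrite !psum_stem /= (minn_idPl (ltnW kj)) (minn_idPl kj).
  rewrite ltn_eqF // [(j < k)%N]ltnNge ltnW // ltnNge kj /=; ring.
rewrite at_lt // [(stem _ _ _ j).1 i]/= ij ltn_eqF //.
have -> : \sum_(k < i) S k *
    ((stem s' v' w' j).2 k + psum (stem s' v' w' j).1 k +
     psum (stem s' v' w' j).1 k.+1 - tot) = s' * psum S i ^+ 2 - psum S i * tot.
  rewrite (eq_bigr (fun k : 'I_i =>
      S k * (s' * (psum S k + psum S k.+1) - tot))).
    move: tot {totE at_lt} => tot; elim: i {ij} => [|i IH].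
      by rewrite /psum !big_ord0; ring.
    by rewrite big_ord_recr /= IH !psumS; ring.
  by move=> k _; rewrite at_lt // (ltn_trans (ltn_ord k)).
by rewrite psumS; move: tot {totE at_lt} => tot /=; ring.
Qed.

Lemma skew_form_stem_eq n s v w s' v' w' i : (i < n)%N ->
  skew_form n (stem s v w i) (stem s' v' w' i) =
  - s * v' * psum S i + s' * v * psum S i + v * w' - w * v'.
Proof.
move=> lt; rewrite skew_form_stem //.
set tot := psum _ n; have totE : tot = s' * psum S i + v'.
  by rewrite /tot psum_stem (minn_idPr (ltnW lt)) lt mulr1.
have at_lt k : (k < i)%N ->
    ((stem s' v' w' i).2 k + psum (stem s' v' w' i).1 k +
     psum (stem s' v' w' i).1 k.+1 - tot = s' * (psum S k + psum S k.+1) - tot).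
  move=> ki; rewrite !psum_stem /= (minn_idPl (ltnW ki)) (minn_idPl ki).
  rewrite ltn_eqF // [(i < k)%N]ltnNge ltnW // ltnNge ki /=; ring.
have -> : \sum_(k < i) S k *
    ((stem s' v' w' i).2 k + psum (stem s' v' w' i).1 k +
     psum (stem s' v' w' i).1 k.+1 - tot) = s' * psum S i ^+ 2 - psum S i * tot.
  rewrite (eq_bigr (fun k : 'I_i =>
      S k * (s' * (psum S k + psum S k.+1) - tot))).
    move: tot {totE at_lt} => tot; elim: i {lt} => [|i IH].
      by rewrite /psum !big_ord0; ring.
    by rewrite big_ord_recr /= IH !psumS; ring.
  by move=> k _; rewrite at_lt.
rewrite !psum_stem minnn (minn_idPr (leqnSn i)) ltnn ltnSn /= ltnn eqxx.
by rewrite totE /=; ring.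
Qed.

End Stems.

Definition order_sign (R : realType) (i j : nat) : R := (i < j)%:R - (j < i)%:R.

Section BracketTable.
Context (R : realType) (n : nat) (b : 'I_n) (p : coords R n).
Local Notation x := (absc b p).
Local Notation t := (height b p).
Local Notation w := (weight b p).
Local Notation S := (width b p).

(** For u = S w^2 / (1 + w^2) and t = S w / (1 + w^2) with w = exp Z, the
    derivatives along Z are 2 t^2 / S and t (1 - w^2) / (1 + w^2). *)
Definition cov_absc i := stem S 1 (x i - foot b p i) (2 * t i ^+ 2 / S i) i.
Definition cov_height i :=
  stem S 0 (t i) (t i * (1 - w i ^+ 2) / (1 + w i ^+ 2)) i.
Definition cov_end := stem S 1 0 0 n.

Local Notation "<< u , v >>" := (skew_form n u v) (at level 0).

Lemma psum_width i : psum S i = foot b p i. Proof. by []. Qed.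

Lemma width_gt0 i : 0 < S i.
Proof. by rewrite exprn_gt0 // root_width_gt0. Qed.

Lemma height_gt0 i : 0 < t i.
Proof.
apply: mulr_gt0; first exact: width_gt0.
have w0 := weight_gt0 b p i.
by apply: divr_gt0 => //; rewrite addr_gt0 // exprn_gt0.
Qed.

Ltac table_field i :=
  rewrite /absc /height;
  have := width_gt0 i; have := weight_gt0 b p i;
  move: (S i) (w i) => Si wi wi0 Si0;
  field; rewrite ?gt_eqF ?addr_gt0 ?exprn_gt0 //.

Lemma skew_absc_lt i s v' w' j : (i < j)%N -> (j <= n)%N ->
  << cov_absc i, stem S s v' w' j >> =
  s * (x i ^+ 2 - t i ^+ 2) - x i * (s * foot b p j + v' * (j < n)%:R).
Proof.
move=> ij jn; rewrite skew_form_stem_lt // !psum_width.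
move: (foot b p j) => fj.
table_field i.
Qed.

Lemma skew_height_lt i s v' w' j : (i < j)%N -> (j <= n)%N ->
  << cov_height i, stem S s v' w' j >> =
  2 * s * t i * x i - t i * (s * foot b p j + v' * (j < n)%:R).
Proof.
move=> ij jn; rewrite skew_form_stem_lt // !psum_width.
move: (foot b p j) => fj.
table_field i.
Qed.

(** Each bracket is a part independent of the order of the positions plus the
    order sign times a second part; both are also correct for equal positions,
    where the sign is 0.  Due to this, the brackets of chords and loops need
    no separate treatment of coinciding indices. *)
Lemma skew_absc_absc i j : (i < n)%N -> (j < n)%N ->
  << cov_absc i, cov_absc j >> =
  ((x i ^+ 2 - t i ^+ 2) - (x j ^+ 2 - t j ^+ 2)) / 2 + order_sign R i j / 2 *
  ((x i ^+ 2 - t i ^+ 2) + (x j ^+ 2 - t j ^+ 2) - 2 * x i * x j).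
Proof.
move=> lin ljn; rewrite /order_sign; case: ltngtP => [ij|ji|->].
- by rewrite skew_absc_lt ?ljn ?(ltnW ljn) //= ?mulr1n; field.
- by rewrite skew_formC skew_absc_lt ?lin ?(ltnW lin) //= ?mulr1n; field.
- rewrite skew_form_stem_eq // psum_width /=; field.
  by rewrite gt_eqF ?width_gt0.
Qed.

Lemma skew_absc_height i j : (i < n)%N -> (j < n)%N ->
  << cov_absc i, cov_height j >> =
  - x j * t j + order_sign R i j * (x j * t j - x i * t j).
Proof.
move=> lin ljn; rewrite /order_sign; case: ltngtP => [ij|ji|->].
- by rewrite skew_absc_lt ?ljn ?(ltnW ljn) //= ?mulr1n; field.
- by rewrite skew_formC skew_height_lt ?lin ?(ltnW lin) //= ?mulr1n; field.
- by rewrite skew_form_stem_eq // !psum_width /=; table_field j.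
Qed.

Lemma skew_height_absc i j : (i < n)%N -> (j < n)%N ->
  << cov_height i, cov_absc j >> =
  x i * t i + order_sign R i j * (x i * t i - x j * t i).
Proof.
by move=> lin ljn; rewrite skew_formC skew_absc_height // /order_sign; ring.
Qed.

Lemma skew_height_height i j : (i < n)%N -> (j < n)%N ->
  << cov_height i, cov_height j >> = - order_sign R i j * t i * t j.
Proof.
move=> lin ljn; rewrite /order_sign; case: ltngtP => [ij|ji|->].
- by rewrite skew_height_lt ?ljn ?(ltnW ljn) //=; ring.
- by rewrite skew_formC skew_height_lt ?lin ?(ltnW lin) //=; ring.
- by rewrite skew_form_stem_eq //=; ring.
Qed.

Lemma skew_absc_end i : (i < n)%N ->
  << cov_absc i, cov_end >> = x i ^+ 2 - t i ^+ 2 - x i * foot b p n.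
Proof. by move=> lin; rewrite skew_absc_lt //=; ring. Qed.

Lemma skew_height_end i : (i < n)%N ->
  << cov_height i, cov_end >> = t i * (2 * x i - foot b p n).
Proof. by move=> lin; rewrite skew_height_lt //=; ring. Qed.

Lemma skew_end_absc i : (i < n)%N ->
  << cov_end, cov_absc i >> = x i * foot b p n - x i ^+ 2 + t i ^+ 2.
Proof. by move=> lin; rewrite skew_formC skew_absc_end //; ring. Qed.

Lemma skew_end_height i : (i < n)%N ->
  << cov_end, cov_height i >> = t i * (foot b p n - 2 * x i).
Proof. by move=> lin; rewrite skew_formC skew_height_end //; ring. Qed.

Lemma skew_end_end : << cov_end, cov_end >> = 0.
Proof. by have := skew_formC n cov_end cov_end; lra. Qed.

End BracketTable.

(** * Derivatives along lines *)

Section DirectionalDerivatives.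
Context (R : realType) (n : nat).
Implicit Types (p v : coords R n) (f g : coords R n -> R) (d : R).

(** The derivative in direction [v] is that of a function of one real variable,
    for which quotients and compositions are governed by ordinary calculus. *)
Definition has_deriv p v f d : Prop :=
  is_derive (0 : R) (1 : R) (fun h : R => f (h *: v + p) : R) d.

Lemma has_deriv_derive p v f d :
  has_deriv p v f d -> 'D_v (f : 'rV[R]_n * 'rV[R]_n -> R^o) p = d.
Proof.
move=> [_ <-]; rewrite /derive.
suff -> : (fun h : R =>
    h^-1 *: (((fun h0 : R => f (h0 *: v + p) : R) \o shift 0) (h *: 1) -
             f (0 *: v + p))) =
  (fun h : R => h^-1 *: ((f \o shift p) (h *: v) - f p)) by [].
by apply: funext => h; rewrite /= addr0 scale0r add0r [h *: 1]mulr1.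
Qed.

Lemma has_deriv_eq p v f d d' :
  has_deriv p v f d -> d = d' -> has_deriv p v f d'.
Proof. by move=> fd <-. Qed.

Lemma has_deriv_cst p v (c : R) : has_deriv p v (fun=> c) 0.
Proof. exact: is_derive_cst. Qed.

Lemma has_deriv_add p v f g d d' :
  has_deriv p v f d -> has_deriv p v g d' ->
  has_deriv p v (fun q => f q + g q) (d + d').
Proof. by move=> fd gd'; exact: is_deriveD. Qed.

Lemma has_deriv_sub p v f g d d' :
  has_deriv p v f d -> has_deriv p v g d' ->
  has_deriv p v (fun q => f q - g q) (d - d').
Proof. by move=> fd gd'; exact: is_deriveB. Qed.

Lemma has_deriv_mul p v f g d d' :
  has_deriv p v f d -> has_deriv p v g d' ->
  has_deriv p v (fun q => f q * g q) (d * g p + f p * d').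
Proof.
move=> fd gd'; have := is_deriveM fd gd'; rewrite /has_deriv.
by rewrite scale0r add0r addrC [_ *: d]mulrC.
Qed.

Lemma has_deriv_inv p v f d : f p != 0 ->
  has_deriv p v f d -> has_deriv p v (fun q => (f q)^-1) (- d / f p ^+ 2).
Proof.
move=> fp fd; have := is_deriveV _ fd; rewrite scale0r add0r => /(_ fp).
by rewrite /has_deriv; congr is_derive; rewrite [LHS]mulrC mulrN mulNr.
Qed.

Lemma has_deriv_expR p v f d :
  has_deriv p v f d -> has_deriv p v (fun q => expR (f q)) (expR (f p) * d).
Proof.
move=> fd; have := is_derive1_comp (is_derive_expR (f (0 *: v + p))) fd.
by rewrite scale0r add0r.
Qed.

Lemma has_deriv_sum p v m (f : 'I_m -> coords R n -> R) (d : 'I_m -> R) :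
  (forall k, has_deriv p v (f k) (d k)) ->
  has_deriv p v (fun q => \sum_k f k q) (\sum_k d k).
Proof.
move=> fd; have := is_derive_sum fd; rewrite /has_deriv.
by congr is_derive; apply: funext => h; rewrite fct_sumE.
Qed.

Lemma affine_deriv (c d : R) :
  is_derive (0 : R) (1 : R) (fun h : R => h * c + d : R) c.
Proof.
rewrite (_ : (fun h => _) = (@id R : R -> R) * cst c + cst d) //.
by apply: is_derive_eq; rewrite addr0 scaler0 add0r [_ *: _]mulr1.
Qed.

Lemma has_deriv_coordY p v k : has_deriv p v (fun q => coordY q k) (coordY v k).
Proof.
rewrite /has_deriv (_ : (fun h => _) = fun h : R => h * v.1 0 k + p.1 0 k).
  exact: affine_deriv.
by apply: funext => h; rewrite /coordY !mxE.
Qed.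

Lemma has_deriv_coordZ p v k : has_deriv p v (fun q => coordZ q k) (coordZ v k).
Proof.
rewrite /has_deriv (_ : (fun h => _) = fun h : R => h * v.2 0 k + p.2 0 k).
  exact: affine_deriv.
by apply: funext => h; rewrite /coordZ !mxE.
Qed.

End DirectionalDerivatives.

(** * Differentials of the coordinates of the half-turns *)

Section WindowDerivatives.
Context (R : realType) (n : nat) (b : 'I_n) (p : coords R n).
Implicit Types (v : coords R n) (a e m k : nat).
Local Notation vtx := (vtx b).
Local Notation x := (absc b p).
Local Notation t := (height b p).
Local Notation w := (weight b p).
Local Notation S := (width b p).

(** Being linear in the coordinates, log S_a is its own derivative. *)
Definition log_width v a : R := \sum_(k < a) coordY v (vtx k).

Definition d_foot a v : R := \sum_(k < a) S k * log_width v k.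
Definition d_absc a v : R := d_foot a v + (x a - foot b p a) * log_width v a +
  2 * t a ^+ 2 / S a * coordZ v (vtx a).
Definition d_height a v : R := t a * log_width v a +
  t a * (1 - w a ^+ 2) / (1 + w a ^+ 2) * coordZ v (vtx a).

Lemma has_deriv_root_width v a :
  has_deriv p v (fun q => root_width b q a)
    (root_width b p a * (log_width v a / 2)).
Proof.
apply: has_deriv_expR; apply: has_deriv_eq.
  apply: has_deriv_mul; last exact: has_deriv_cst.
  by apply: has_deriv_sum => k; exact: has_deriv_coordY.
by rewrite mulr0 addr0.
Qed.

Lemma has_deriv_width v a :
  has_deriv p v (fun q => width b q a) (S a * log_width v a).
Proof.
apply: has_deriv_eq; first exact: has_deriv_mul (has_deriv_root_width v a)
  (has_deriv_root_width v a).
by rewrite /width; field.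
Qed.

Lemma has_deriv_foot v a : has_deriv p v (fun q => foot b q a) (d_foot a v).
Proof. by apply: has_deriv_sum => k; exact: has_deriv_width. Qed.

Lemma has_deriv_weight v a :
  has_deriv p v (fun q => weight b q a) (w a * coordZ v (vtx a)).
Proof. by apply: has_deriv_expR; exact: has_deriv_coordZ. Qed.

Lemma has_deriv_absc v a : has_deriv p v (fun q => absc b q a) (d_absc a v).
Proof.
have q0 : 1 + w a ^+ 2 != 0.
  by rewrite gt_eqF // addr_gt0 // exprn_gt0 // weight_gt0.
have dw2 := has_deriv_mul (has_deriv_weight v a) (has_deriv_weight v a).
have dw2D := has_deriv_add (has_deriv_cst p v 1) dw2.
apply: has_deriv_eq; first exact: has_deriv_add (has_deriv_foot v a)
  (has_deriv_mul (has_deriv_width v a)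
     (has_deriv_mul dw2 (has_deriv_inv q0 dw2D))).
rewrite /d_absc /absc /height; move: q0; have := width_gt0 b p a.
move: (d_foot a v) (S a) (w a) (log_width v a) (coordZ v _) (foot b p a).
by move=> df Sa wa la za fa Sa0 q0; field; rewrite q0 gt_eqF.
Qed.

Lemma has_deriv_height v a :
  has_deriv p v (fun q => height b q a) (d_height a v).
Proof.
have q0 : 1 + w a ^+ 2 != 0.
  by rewrite gt_eqF // addr_gt0 // exprn_gt0 // weight_gt0.
have dw2 := has_deriv_mul (has_deriv_weight v a) (has_deriv_weight v a).
have dw2D := has_deriv_add (has_deriv_cst p v 1) dw2.
apply: has_deriv_eq; first exact: has_deriv_mul (has_deriv_width v a)
     (has_deriv_mul (has_deriv_weight v a) (has_deriv_inv q0 dw2D)).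
rewrite /d_height /height; move: q0; have := width_gt0 b p a.
move: (S a) (w a) (log_width v a) (coordZ v _).
by move=> Sa wa la za Sa0 q0; field; rewrite q0.
Qed.

Definition dirY (k : 'I_n) : coords R n := (delta_mx 0 k, 0).
Definition dirZ (k : 'I_n) : coords R n := (0, delta_mx 0 k).

Definition cov_of (D : coords R n -> R) : (nat -> R) * (nat -> R) :=
  (fun e => D (dirY (ord_pred (vtx e))) - D (dirY (vtx e)),
   fun e => D (dirZ (vtx e))).

Lemma covectorE f D : (forall v, has_deriv p v f (D v)) ->
  covector b f p = cov_of D.
Proof.
move=> fD; congr pair; apply: funext => e.
  by congr (_ - _); exact: has_deriv_derive.
exact: has_deriv_derive.
Qed.

Lemma n_gt0 : (0 < n)%N. Proof. by case: n b => // -[]. Qed.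

Lemma vtx_inj m k : (m < n)%N -> (k < n)%N -> (vtx m == vtx k) = (m == k).
Proof. by move=> mn kn; rewrite vtx_eq !modn_small. Qed.

Lemma log_width_dirY m a : (m < n)%N -> (a <= n)%N ->
  log_width (dirY (vtx m)) a = (m < a)%:R.
Proof.
move=> mn; rewrite /log_width; elim: a => [|a IH] an; first by rewrite big_ord0.
rewrite big_ord_recr /= (IH (ltnW an)) /coordY /= mxE eqxx /= vtx_inj // ltnS.
by case: ltngtP => _; rewrite ?addr0 ?add0r.
Qed.

Lemma log_width_dirZ m a : log_width (dirZ (vtx m)) a = 0.
Proof. by rewrite /log_width big1 // => k _; rewrite /coordY mxE. Qed.

Lemma coordZ_dirY (k l : 'I_n) : coordZ (dirY k) l = 0.
Proof. by rewrite /coordZ /= mxE. Qed.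

Lemma coordZ_dirZ m a : (m < n)%N -> (a < n)%N ->
  coordZ (dirZ (vtx m)) (vtx a) = (a == m)%:R.
Proof. by move=> mn an; rewrite /coordZ /= mxE eqxx vtx_inj. Qed.

Lemma ord_pred_vtx e : (e < n)%N ->
  ord_pred (vtx e) = vtx (if e is e'.+1 then e' else n.-1).
Proof.
case: e => [|e] en; last by rewrite /= ordSK.
have -> : vtx 0 = ordS (vtx n.-1); last exact: ordSK.
by rewrite -[RHS]/(vtx n.-1.+1) prednK ?n_gt0 //; exact: esym (vtxDn b 0).
Qed.

(** The correction at position 0 is the price of normalising S_0 = 1: shifting
    log S_0 amounts to rescaling all the other widths inversely. *)
Lemma log_width_step e a : (e < n)%N -> (a < n)%N ->
  log_width (dirY (ord_pred (vtx e))) a - log_width (dirY (vtx e)) a =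
  (e == a)%:R - (e == 0)%:R.
Proof.
move=> en an; have an' := ltnW an.
rewrite ord_pred_vtx // !log_width_dirY //; last first.
  by case: e en => [|e] en; [rewrite prednK ?n_gt0 | exact: ltnW].
case: e en => [|e] _ /=; last first.
  by case: (ltngtP e.+1 a) => _; rewrite ?subr0 ?subrr.
rewrite ltnNge -ltnS prednK ?n_gt0 // an /=.
by case: a {an an'} => [|a]; rewrite ?subrr // !sub0r.
Qed.

End WindowDerivatives.

(** * Differentials of chords and loops *)

Section Covectors.
Context (R : realType) (n : nat) (b : 'I_n) (p : coords R n).
Local Notation vtx := (vtx b).
Local Notation x := (absc b p).
Local Notation t := (height b p).
Local Notation S := (width b p).
Local Notation lam := (width b p n).
Local Notation mu := (foot b p n).

Lemma log_width_turn_dirY (k : 'I_n) : log_width b (dirY R k) n = 1.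
Proof. by have [m mn ->] := vtx_surj b k; rewrite log_width_dirY // mn. Qed.

Lemma log_width_turn_step e :
  log_width b (dirY R (ord_pred (vtx e))) n -
  log_width b (dirY R (vtx e)) n = 0.
Proof. by rewrite !log_width_turn_dirY subrr. Qed.

(** The differential of a coordinate agrees with its stem up to a correction at
    position 0, which comes from the normalisation S_0 = 1; there, [eps] is the
    value of the coordinate.  For a scale-invariant function, Euler's identity
    makes these corrections add up to 0. *)
Definition represents (D : coords R n -> R) (u : (nat -> R) * (nat -> R))
    (eps : R) :=
  forall e, (e < n)%N -> (cov_of b D).1 e = u.1 e - (e == 0)%:R * eps /\
    (cov_of b D).2 e = u.2 e.

Lemma represents_nil : represents (fun=> 0) (comb [::]) 0.
Proof.
by move=> e _; rewrite /cov_of /comb /= !big_nil; split=> //; ring.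
Qed.

(** Every function of lam = [width b p n] is a Casimir. *)
Lemma represents_turn c :
  represents (fun v => c * log_width b v n) (comb [::]) 0.
Proof.
move=> e en; rewrite /cov_of /comb /= !big_nil log_width_dirZ mulr0.
by rewrite -mulrBr log_width_turn_step; split=> //; ring.
Qed.

Lemma represents_cons c D u eps s D' eps' :
  represents D u eps -> represents D' (comb s) eps' ->
  represents (fun v => c * D v + D' v) (comb ((c, u) :: s)) (c * eps + eps').
Proof.
move=> Du Ds e en; have [Du1 Du2] := Du e en; have [Ds1 Ds2] := Ds e en.
rewrite /cov_of /comb /= !big_cons in Du1 Du2 Ds1 Ds2 *.
split; last by rewrite Du2 Ds2.
by rewrite opprD addrACA -mulrBr Du1 Ds1 /=; ring.
Qed.

Lemma cov_of_foot e a : (e < n)%N -> (a <= n)%N ->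
  (cov_of b (d_foot b p a)).1 e = S e * (e < a)%:R - (e == 0)%:R * foot b p a /\
  (cov_of b (d_foot b p a)).2 e = 0.
Proof.
move=> en an; rewrite /cov_of /=; split; last first.
  by rewrite /d_foot big1 // => k _; rewrite log_width_dirZ mulr0.
elim: a an => [|a IH] an.
  by rewrite /d_foot /foot !big_ord0 ltn0 /=; ring.
have dS v : d_foot b p a.+1 v = d_foot b p a v + S a * log_width b v a.
  by rewrite /d_foot big_ord_recr.
rewrite !dS footS opprD addrACA -mulrBr (IH (ltnW an)) log_width_step //.
by rewrite ltnS; case: (ltngtP e a) => [_|_|->] /=; ring.
Qed.

Lemma represents_absc a : (a < n)%N ->
  represents (d_absc b p a) (cov_absc b p a) (x a).
Proof.
move=> an e en; have [foot1 foot2] := cov_of_foot en (ltnW an).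
rewrite /cov_of /= in foot1 foot2.
rewrite /cov_of /d_absc /= foot2 log_width_dirZ coordZ_dirZ // !coordZ_dirY.
split; last by rewrite [a == e]eq_sym; ring.
have step := log_width_step R b en an.
move: foot1 step; set D1 := d_foot _ _ _ _; set D2 := d_foot _ _ _ _.
set l1 := log_width _ _ _; set l2 := log_width _ _ _ => foot1 step.
have -> : D1 = D2 + (S e * (e < a)%:R - (e == 0)%:R * foot b p a).
  by rewrite -foot1 addrC subrK.
have -> : l1 = l2 + ((e == a)%:R - (e == 0)%:R) by rewrite -step addrC subrK.
by rewrite /cov_absc /stem /=; ring.
Qed.

Lemma represents_height a : (a < n)%N ->
  represents (d_height b p a) (cov_height b p a) (t a).
Proof.
move=> an e en.
rewrite /cov_of /d_height /= log_width_dirZ coordZ_dirZ // !coordZ_dirY.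
split; last by rewrite [a == e]eq_sym; ring.
have step := log_width_step R b en an.
move: step; set l1 := log_width _ _ _; set l2 := log_width _ _ _ => step.
have -> : l1 = l2 + ((e == a)%:R - (e == 0)%:R) by rewrite -step addrC subrK.
by rewrite /cov_height /stem /=; ring.
Qed.

Lemma represents_end : represents (d_foot b p n) (cov_end b p) mu.
Proof.
move=> e en; have [-> ->] := cov_of_foot en (leqnn n).
by rewrite /cov_end /stem /=; split; ring.
Qed.

Definition chord_dx (x t x' t' : R) : R := 2 * (x - x') / (t * t').
Definition chord_dt (x t x' t' : R) : R :=
  (t ^+ 2 - t' ^+ 2 - (x' - x) ^+ 2) / (t ^+ 2 * t').

Lemma has_deriv_chord v (X T X' T' : coords R n -> R) dX dT dX' dT' :
  T p != 0 -> T' p != 0 ->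
  has_deriv p v X dX -> has_deriv p v T dT ->
  has_deriv p v X' dX' -> has_deriv p v T' dT' ->
  has_deriv p v (fun q => chord (X q) (T q) (X' q) (T' q))
    (chord_dx (X p) (T p) (X' p) (T' p) * dX +
     chord_dt (X p) (T p) (X' p) (T' p) * dT +
     chord_dx (X' p) (T' p) (X p) (T p) * dX' +
     chord_dt (X' p) (T' p) (X p) (T p) * dT').
Proof.
move=> T0 T'0 HX HT HX' HT'.
have TT'0 : T p * T' p != 0 by rewrite mulf_neq0.
have HB := has_deriv_sub HX' HX.
apply: has_deriv_eq; first exact: has_deriv_mul
  (has_deriv_add (has_deriv_add (has_deriv_mul HB HB) (has_deriv_mul HT HT))
     (has_deriv_mul HT' HT')) (has_deriv_inv TT'0 (has_deriv_mul HT HT')).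
rewrite /chord_dx /chord_dt.
move: (X p) (T p) (X' p) (T' p) T0 T'0 {TT'0 HX HT HX' HT' HB}.
by move=> x1 t1 x2 t2 t10 t20; field; rewrite t10.
Qed.

(** An inner chord avoids the cut, an outer chord crosses it. *)
Definition inner_chord (i j : nat) (q : coords R n) : R :=
  chord (absc b q i) (height b q i) (absc b q j) (height b q j).

Definition outer_chord (i j : nat) (q : coords R n) : R :=
  chord (absc b q i) (height b q i)
    (width b q n * absc b q j + foot b q n) (width b q n * height b q j).

Definition loop (i : nat) (q : coords R n) : R :=
  ((width b q n - 1) * absc b q i + foot b q n) /
  (height b q i * root_width b q n).

Definition cov_inner i j := comb
  [:: (chord_dx (x i) (t i) (x j) (t j), cov_absc b p i);
      (chord_dt (x i) (t i) (x j) (t j), cov_height b p i);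
      (chord_dx (x j) (t j) (x i) (t i), cov_absc b p j);
      (chord_dt (x j) (t j) (x i) (t i), cov_height b p j)].

Definition cov_outer i j := 
  let x' := lam * x j + mu in let t' := lam * t j in comb
  [:: (chord_dx (x i) (t i) x' t', cov_absc b p i);
      (chord_dt (x i) (t i) x' t', cov_height b p i);
      (lam * chord_dx x' t' (x i) (t i), cov_absc b p j);
      (lam * chord_dt x' t' (x i) (t i), cov_height b p j);
      (chord_dx x' t' (x i) (t i), cov_end b p)].

Definition cov_loop i := comb
  [:: ((lam - 1) / (t i * root_width b p n), cov_absc b p i);
      (- loop i p / t i, cov_height b p i);
      ((t i * root_width b p n)^-1, cov_end b p)].


Lemma represents_covector f D u : (forall v, has_deriv p v f (D v)) ->
  represents D u 0 -> forall e, (e < n)%N ->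
  (covector b f p).1 e = u.1 e /\ (covector b f p).2 e = u.2 e.
Proof.
move=> fD Du e en; rewrite (covectorE b fD); have [-> ->] := Du e en.
by rewrite mulr0 subr0.
Qed.

(** Euler's identity for the function [chord], homogeneous of degree 0. *)
Lemma chord_homogeneous x1 t1 x2 t2 : t1 != 0 -> t2 != 0 ->
  chord_dx x1 t1 x2 t2 * x1 + (chord_dt x1 t1 x2 t2 * t1 +
  (chord_dx x2 t2 x1 t1 * x2 + (chord_dt x2 t2 x1 t1 * t2 + 0))) = 0.
Proof.
by move=> t10 t20; rewrite /chord_dx /chord_dt; field; rewrite t10.
Qed.

Lemma covector_inner i j : (i < n)%N -> (j < n)%N -> forall e, (e < n)%N ->
  (covector b (inner_chord i j) p).1 e = (cov_inner i j).1 e /\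
  (covector b (inner_chord i j) p).2 e = (cov_inner i j).2 e.
Proof.
move=> lin ljn; have ti0 := lt0r_neq0 (height_gt0 b p i).
have tj0 := lt0r_neq0 (height_gt0 b p j).
apply: (represents_covector (D := fun v =>
  chord_dx (x i) (t i) (x j) (t j) * d_absc b p i v +
  (chord_dt (x i) (t i) (x j) (t j) * d_height b p i v +
  (chord_dx (x j) (t j) (x i) (t i) * d_absc b p j v +
  (chord_dt (x j) (t j) (x i) (t i) * d_height b p j v + 0))))) => [v|].
  apply: has_deriv_eq; first exact: (has_deriv_chord ti0 tj0
    (has_deriv_absc b p v i) (has_deriv_height b p v i)
    (has_deriv_absc b p v j) (has_deriv_height b p v j)).
  by rewrite addr0 !addrA.
rewrite -[X in represents _ _ X](chord_homogeneous (x i) (x j) ti0 tj0).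
exact: (represents_cons _ (represents_absc lin) (represents_cons _
  (represents_height lin) (represents_cons _ (represents_absc ljn)
  (represents_cons _ (represents_height ljn) represents_nil)))).
Qed.

Lemma covector_outer i j : (i < n)%N -> (j < n)%N -> forall e, (e < n)%N ->
  (covector b (outer_chord i j) p).1 e = (cov_outer i j).1 e /\
  (covector b (outer_chord i j) p).2 e = (cov_outer i j).2 e.
Proof.
move=> lin ljn; rewrite /cov_outer.
set x' := lam * x j + mu; set t' := lam * t j.
have ti0 := lt0r_neq0 (height_gt0 b p i).
have t'0 : t' != 0 by rewrite gt_eqF // mulr_gt0 // ?width_gt0 ?height_gt0.
apply: (represents_covector (D := fun v =>
  chord_dx (x i) (t i) x' t' * d_absc b p i v +
  (chord_dt (x i) (t i) x' t' * d_height b p i v +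
  (lam * chord_dx x' t' (x i) (t i) * d_absc b p j v +
  (lam * chord_dt x' t' (x i) (t i) * d_height b p j v +
  (chord_dx x' t' (x i) (t i) * d_foot b p n v +
  lam * (chord_dx x' t' (x i) (t i) * x j + chord_dt x' t' (x i) (t i) * t j) *
    log_width b v n)))))) => [v|].
  have dlam := has_deriv_width b p v n.
  apply: has_deriv_eq; first exact: (has_deriv_chord
    (T := fun q => height b q i) (T' := fun q => width b q n * height b q j)
    ti0 t'0
    (has_deriv_absc b p v i) (has_deriv_height b p v i)
    (has_deriv_add (has_deriv_mul dlam (has_deriv_absc b p v j))
      (has_deriv_foot b p v n))
    (has_deriv_mul dlam (has_deriv_height b p v j))).
  rewrite -/x' -/t'.
  move: (chord_dx _ _ _ _) (chord_dt _ _ _ _).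
  move: (chord_dx _ _ _ _) (chord_dt _ _ _ _).
  by move=> c1 c2 c3 c4; ring.
rewrite [X in represents _ _ X](_ : 0 = chord_dx (x i) (t i) x' t' * x i +
  (chord_dt (x i) (t i) x' t' * t i +
  (lam * chord_dx x' t' (x i) (t i) * x j +
  (lam * chord_dt x' t' (x i) (t i) * t j +
  (chord_dx x' t' (x i) (t i) * mu + 0))))); last first.
  by rewrite -[LHS](chord_homogeneous (x i) x' ti0 t'0) /x' /t'; ring.
exact: (represents_cons _ (represents_absc lin) (represents_cons _
  (represents_height lin) (represents_cons _ (represents_absc ljn)
  (represents_cons _ (represents_height ljn) (represents_cons _ represents_end
  (represents_turn _)))))).
Qed.

Lemma covector_loop i : (i < n)%N -> forall e, (e < n)%N ->
  (covector b (loop i) p).1 e = (cov_loop i).1 e /\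
  (covector b (loop i) p).2 e = (cov_loop i).2 e.
Proof.
move=> lin.
have ti0 := lt0r_neq0 (height_gt0 b p i).
have r0 := lt0r_neq0 (root_width_gt0 b p n).
have tr0 : t i * root_width b p n != 0 by rewrite mulf_neq0.
apply: (represents_covector (D := fun v =>
  (lam - 1) / (t i * root_width b p n) * d_absc b p i v +
  (- loop i p / t i * d_height b p i v +
  ((t i * root_width b p n)^-1 * d_foot b p n v +
  (lam * x i / (t i * root_width b p n) - loop i p / 2) *
    log_width b v n)))) => [v|].
  have dlam := has_deriv_width b p v n.
  apply: has_deriv_eq; first exact: (has_deriv_mul (has_deriv_add (has_deriv_mul
    (has_deriv_sub dlam (has_deriv_cst p v 1)) (has_deriv_absc b p v i))
      (has_deriv_foot b p v n))
    (has_deriv_inv (f := fun q => height b q i * root_width b q n) tr0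
      (has_deriv_mul (has_deriv_height b p v i)
        (has_deriv_root_width b p v n)))).
  rewrite /loop; move: ti0 r0; rewrite /width.
  move: (x i) (t i) (root_width b p n) (foot b p n) (d_absc _ _ _ _)
    (d_height _ _ _ _) (d_foot _ _ _ _) (log_width _ _ _).
  by move=> xi ti r m dx dt dm l ti0 r0; field; rewrite ?ti0 ?r0.
rewrite [X in represents _ _ X](_ : 0 =
  (lam - 1) / (t i * root_width b p n) * x i +
  (- loop i p / t i * t i +
  ((t i * root_width b p n)^-1 * mu + 0))); last first.
  rewrite /loop; move: ti0 r0; rewrite /width.
  move: (x i) (t i) (root_width b p n) (foot b p n).
  by move=> xi ti r m ti0 r0; field; rewrite ?ti0 ?r0.
exact: (represents_cons _ (represents_absc lin) (represents_cons _
  (represents_height lin) (represents_cons _ represents_end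
  (represents_turn _)))).
Qed.

End Covectors.

(** * The brackets of chords and loops *)

Section BracketIdentities.
Context (R : realType) (n : nat) (b : 'I_n) (p : coords R n).
Local Notation s := (order_sign R).
Local Notation U i j := (inner_chord b i j p).
Local Notation V i j := (outer_chord b i j p).
Local Notation g i := (loop b i p).

Definition skew_table := (skew_absc_absc, skew_absc_height, skew_height_absc,
  skew_height_height, skew_absc_end, skew_height_end, skew_end_absc,
  skew_end_height, skew_end_end).

(** With the table of brackets, each bracket of chords and loops becomes an
    identity of rational functions in the coordinates of the half-turns, linear
    in the order signs, which are treated as free parameters. *)
Lemma bracket_inner_inner i j k l :
  (i < n)%N -> (j < n)%N -> (k < n)%N -> (l < n)%N ->
  poisson_bracket (inner_chord b i j) (inner_chord b k l) p =
  (s i k - s i l - s j k + s j l) * (U i k * U j l - U i l * U j k).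
Proof.
move=> lin ljn lkn lln; rewrite (poisson_bracketE b).
rewrite (eq_skew_form (covector_inner b p lin ljn)
                      (covector_inner b p lkn lln)).
rewrite /cov_inner skew_form_comb !big_cons !big_nil !skew_table // !addr0.
rewrite /inner_chord.
have := lt0r_neq0 (height_gt0 b p i); have := lt0r_neq0 (height_gt0 b p j).
have := lt0r_neq0 (height_gt0 b p k); have := lt0r_neq0 (height_gt0 b p l).
move: (s _ _) (s _ _) (s _ _) (s _ _).
move: (absc b p _) (height b p _) (absc b p _) (height b p _).
move: (absc b p _) (height b p _) (absc b p _) (height b p _).
rewrite /chord /chord_dx /chord_dt => xl tl xk tk xj tj xi ti sjl sjk sil sik.
move=> tl0 tk0 tj0 ti0 /=.
by field; rewrite ?tl0 ?tk0 ?tj0 ?ti0.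
Qed.

Lemma bracket_inner_outer i j k l :
  (i < n)%N -> (j < n)%N -> (k < n)%N -> (l < n)%N ->
  poisson_bracket (inner_chord b i j) (outer_chord b k l) p =
  (s i k - s j k) * (U i k * V j l - V i l * U j k) +
  (s j l - s i l) * (V k i * U j l - U i l * V k j).
Proof.
move=> lin ljn lkn lln; rewrite (poisson_bracketE b).
rewrite (eq_skew_form (covector_inner b p lin ljn)
                      (covector_outer b p lkn lln)).
rewrite /cov_inner /cov_outer skew_form_comb !big_cons !big_nil.
rewrite !skew_table // !addr0.
rewrite /inner_chord /outer_chord.
have := lt0r_neq0 (height_gt0 b p i); have := lt0r_neq0 (height_gt0 b p j).
have := lt0r_neq0 (height_gt0 b p k); have := lt0r_neq0 (height_gt0 b p l).
have := lt0r_neq0 (width_gt0 b p n).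
move: (s i k) (s i l) (s j k) (s j l) (width b p n) (foot b p n).
move: (absc b p i) (height b p i) (absc b p j) (height b p j).
move: (absc b p k) (height b p k) (absc b p l) (height b p l).
rewrite /chord /chord_dx /chord_dt.
move=> xk tk xl tl xi ti xj tj sik sil sjk sjl lam mu.
move=> lam0 tl0 tk0 tj0 ti0 /=.
by field; rewrite ?tl0 ?tk0 ?tj0 ?ti0 ?lam0.
Qed.

Lemma bracket_inner_loop i j k : (i < n)%N -> (j < n)%N -> (k < n)%N ->
  poisson_bracket (inner_chord b i j) (loop b k) p =
  (s i k - s j k) * (U i k * g j - U j k * g i).
Proof.
move=> lin ljn lkn; rewrite (poisson_bracketE b).
rewrite (eq_skew_form (covector_inner b p lin ljn) (covector_loop b p lkn)).
rewrite /cov_inner /cov_loop skew_form_comb !big_cons !big_nil.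
rewrite !skew_table // !addr0.
rewrite /inner_chord /loop.
have := lt0r_neq0 (height_gt0 b p i); have := lt0r_neq0 (height_gt0 b p j).
have := lt0r_neq0 (height_gt0 b p k); have := lt0r_neq0 (root_width_gt0 b p n).
move: (s i k) (s j k) (width b p n) (root_width b p n) (foot b p n).
move: (absc b p i) (height b p i) (absc b p j) (height b p j).
move: (absc b p k) (height b p k).
rewrite /chord /chord_dx /chord_dt.
move=> xk tk xi ti xj tj sik sjk lam r mu.
move=> r0 tk0 tj0 ti0 /=.
by field; rewrite ?tk0 ?tj0 ?ti0 ?r0.
Qed.

Lemma bracket_loop_loop i j : (i < n)%N -> (j < n)%N ->
  poisson_bracket (loop b i) (loop b j) p =
  (V i j - V j i) / 2 + s i j * (U i j - (V i j + V j i) / 2).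
Proof.
move=> lin ljn; rewrite (poisson_bracketE b).
rewrite (eq_skew_form (covector_loop b p lin) (covector_loop b p ljn)).
rewrite /cov_loop skew_form_comb !big_cons !big_nil !skew_table // !addr0.
rewrite /inner_chord /outer_chord /loop /width.
have := lt0r_neq0 (height_gt0 b p i); have := lt0r_neq0 (height_gt0 b p j).
have := lt0r_neq0 (root_width_gt0 b p n).
move: (s i j) (root_width b p n) (foot b p n).
move: (absc b p i) (height b p i) (absc b p j) (height b p j).
rewrite /chord => xi ti xj tj sij r mu r0 tj0 ti0 /=.
by field; rewrite ?tj0 ?ti0 ?r0.
Qed.

(** If lam is not 1, put the origin at the fixed point of z |-> lam z + mu. Then
    U_ij, V_ij and V_ji are combinations of x_i^2 + t_i^2, x_j^2 + t_j^2 and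
    2 x_i x_j, divided by t_i t_j, while g_i g_j is a multiple of
    x_i x_j / (t_i t_j); hence there must be a relation of this form. *)
Lemma outer_chord_sum i j : V i j + V j i =
  (width b p n + (width b p n)^-1) * U i j + 2 * g i * g j.
Proof.
rewrite /inner_chord /outer_chord /loop /width.
have := lt0r_neq0 (height_gt0 b p i); have := lt0r_neq0 (height_gt0 b p j).
have := lt0r_neq0 (root_width_gt0 b p n).
move: (root_width b p n) (foot b p n).
move: (absc b p i) (height b p i) (absc b p j) (height b p j).
rewrite /chord => xi ti xj tj r mu r0 tj0 ti0 /=.
by field; rewrite ?tj0 ?ti0 ?r0.
Qed.

End BracketIdentities.

(** * Poisson closedness *)

Section ChordPolynomials.
Context (R : realType) (n : nat) (b : 'I_n).
Implicit Types p : coords R n.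
Local Notation vtx := (vtx b).
Local Notation s := (order_sign R).

Lemma G_inner a c : (a < c)%N -> (c < n)%N ->
  G (vtx a) (vtx c) = inner_chord b a c :> (coords R n -> R).
Proof.
move=> ac cn; apply: funext => p; rewrite -{1}(subnKC (ltnW ac)) G_chord.
- by rewrite subnKC // ltnW.
- by rewrite subn_gt0.
- by rewrite (leq_ltn_trans (leq_subr _ _)).
Qed.

Lemma G_outer a c : (c < a)%N -> (a < n)%N ->
  G (vtx a) (vtx c) = outer_chord b a c :> (coords R n -> R).
Proof.
move=> ca an; apply: funext => p; rewrite -(vtxDn b c).
have acn : (a <= c + n)%N by rewrite (leq_trans (ltnW an)) ?leq_addl.
rewrite -{1}(subnKC acn) G_chord ?subnKC // ?abscDn ?heightDn //.
- by rewrite subn_gt0 (leq_trans an) ?leq_addl.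
- by rewrite ltn_subLR // ltn_add2r.
Qed.

Lemma G_diag a : G (vtx a) (vtx a) = loop b a :> (coords R n -> R).
Proof.
by apply: funext => p; rewrite G_loop abscDn /loop; congr (_ / _); ring.
Qed.

Lemma inner_chordC a c p : inner_chord b a c p = inner_chord b c a p.
Proof.
rewrite /inner_chord /chord.
have := lt0r_neq0 (height_gt0 b p a); have := lt0r_neq0 (height_gt0 b p c).
move: (absc b p a) (height b p a) (absc b p c) (height b p c).
by move=> x t x' t' t'0 t0; field; rewrite ?t'0 ?t0.
Qed.

Lemma inner_chord_diag a p : inner_chord b a a p = 2.
Proof.
rewrite /inner_chord /chord.
have := lt0r_neq0 (height_gt0 b p a); move: (absc b p a) (height b p a).
by move=> x t t0; field; rewrite ?t0.
Qed.

Lemma poly_loop a : poly_in_G (loop b a : coords R n -> R).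
Proof. by rewrite -G_diag; exact: poly_in_G_gen. Qed.

Lemma poly_inner_chord a c : (a < n)%N -> (c < n)%N ->
  poly_in_G (inner_chord b a c : coords R n -> R).
Proof.
move=> an cn; case: (ltngtP a c) => [ac|ca|<-].
- by rewrite -G_inner //; exact: poly_in_G_gen.
- apply: (poly_in_G_ext (inner_chordC a c)).
  by rewrite -G_inner //; exact: poly_in_G_gen.
- exact: poly_in_G_ext (inner_chord_diag a) (poly_in_G_cst _ _).
Qed.

Lemma poly_outer_chord a c : (c < a)%N -> (a < n)%N ->
  poly_in_G (outer_chord b a c : coords R n -> R).
Proof. by move=> ca an; rewrite -G_outer //; exact: poly_in_G_gen. Qed.

(** The trace of the square of the monodromy around the hole. *)
Definition holonomy p : R := width b p n + (width b p n)^-1.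

Lemma outer_chord_mod_holonomy a c : (a < n)%N -> (c < n)%N ->
  exists2 f, poly_in_G f & forall p, outer_chord b a c p =
    (1 + s a c) / 2 * holonomy p * inner_chord b a c p + f p.
Proof.
move=> an cn; rewrite /order_sign; case: ltngtP => [ac|ca|->].
- exists (fun p => 2 * loop b a p * loop b c p - outer_chord b c a p).
    apply: poly_in_G_sub (poly_outer_chord ac cn).
    apply: poly_in_G_mul (poly_loop c).
    by apply: poly_in_G_mul (poly_loop a); exact: poly_in_G_cst.
  move=> p; have := outer_chord_sum b p a c; rewrite -/(holonomy p) => sum.
  by rewrite /= -[LHS](addrK (outer_chord b c a p)) sum; field.
- exists (outer_chord b a c); first exact: poly_outer_chord.
  by move=> p /=; field.
- exists (fun p => loop b c p * loop b c p).
    exact: poly_in_G_mul (poly_loop c) (poly_loop c).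
  move=> p; have := outer_chord_sum b p c c; rewrite -/(holonomy p) => sum.
  have -> : outer_chord b c c p =
      (outer_chord b c c p + outer_chord b c c p) / 2.
    by field.
  by rewrite sum /=; field.
Qed.

Lemma poly_bracket_inner_inner i j k l :
  (i < n)%N -> (j < n)%N -> (k < n)%N -> (l < n)%N ->
  poly_in_G (poisson_bracket (inner_chord b i j) (inner_chord b k l)
    : coords R n -> R).
Proof.
move=> lin ljn lkn lln.
apply: (poly_in_G_ext (fun p => bracket_inner_inner b p lin ljn lkn lln)).
apply: poly_in_G_mul (poly_in_G_cst _ _) _.
by apply: poly_in_G_sub; apply: poly_in_G_mul; exact: poly_inner_chord.
Qed.

Lemma poly_bracket_inner_loop i j k :
  (i < n)%N -> (j < n)%N -> (k < n)%N ->
  poly_in_G (poisson_bracket (inner_chord b i j) (loop b k) : coords R n -> R).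
Proof.
move=> lin ljn lkn.
apply: (poly_in_G_ext (fun p => bracket_inner_loop b p lin ljn lkn)).
apply: poly_in_G_mul (poly_in_G_cst _ _) _.
have inner a : (a < n)%N -> poly_in_G (inner_chord b a k : coords R n -> R).
  by move=> an; exact: poly_inner_chord.
by apply: poly_in_G_sub; apply: poly_in_G_mul (poly_loop _); exact: inner.
Qed.

Lemma poly_bracket_loop_loop i j : (i < n)%N -> (j < n)%N ->
  poly_in_G (poisson_bracket (loop b i) (loop b j) : coords R n -> R).
Proof.
move=> lin ljn; apply: (poly_in_G_ext (fun p => bracket_loop_loop b p lin ljn)).
have inner := poly_inner_chord lin ljn.
rewrite /order_sign; case: ltngtP => [ij|ji|->].
- apply: (poly_in_G_ext (g := fun p =>
      inner_chord b i j p - outer_chord b j i p)).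
    by move=> p /=; field.
  exact: poly_in_G_sub inner (poly_outer_chord ij ljn).
- apply: (poly_in_G_ext (g := fun p =>
      outer_chord b i j p - inner_chord b i j p)).
    by move=> p /=; field.
  exact: poly_in_G_sub (poly_outer_chord ji lin) inner.
- apply: (poly_in_G_ext (g := fun=> 0)); last exact: poly_in_G_cst.
  by move=> p /=; field.
Qed.

(** If a lies outside the interval from l to k, the two signs agree; if it lies
    inside, they are opposite; at an end point one of them is 0. *)
Lemma order_sign_separation a k l : (l < k)%N ->
  s a k - s a l + s a k * s a l = 1.
Proof.
rewrite /order_sign => lk; case: (ltngtP a k) => [ak|ka|->].
- by case: (ltngtP a l) => _ /=; ring.
- by have := ltn_trans lk ka; case: (ltngtP a l) => // _ _ /=; ring.
- by rewrite lk ltnNge (ltnW lk) /=; ring.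
Qed.

(** The coefficient of [holonomy] is half of U_ik U_jl - U_il U_jk times the
    difference of the values of the expression of [order_sign_separation] at i
    and at j. *)
Lemma poly_bracket_inner_outer i j k l :
  (i < n)%N -> (j < n)%N -> (l < k)%N -> (k < n)%N ->
  poly_in_G (poisson_bracket (inner_chord b i j) (outer_chord b k l)
    : coords R n -> R).
Proof.
move=> lin ljn lk lkn; have lln := ltn_trans lk lkn.
apply: (poly_in_G_ext (fun p => bracket_inner_outer b p lin ljn lkn lln)).
have [fjl pjl jlE] := outer_chord_mod_holonomy ljn lln.
have [fil pil ilE] := outer_chord_mod_holonomy lin lln.
have [fki pki kiE] := outer_chord_mod_holonomy lkn lin.
have [fkj pkj kjE] := outer_chord_mod_holonomy lkn ljn.
have pU a c : (a < n)%N -> (c < n)%N -> poly_in_G (inner_chord b a c) :=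
  @poly_inner_chord a c.
apply: (poly_in_G_ext (g := fun p =>
  (s i k - s j k) *
    (inner_chord b i k p * fjl p - fil p * inner_chord b j k p) +
  (s j l - s i l) *
    (fki p * inner_chord b j l p - inner_chord b i l p * fkj p))).
  move=> p; rewrite jlE ilE kiE kjE !(inner_chordC k).
  have ski a : s k a = - s a k by rewrite /order_sign opprB.
  rewrite !ski.
  have := order_sign_separation i lk; have := order_sign_separation j lk.
  move: (s i k) (s i l) (s j k) (s j l) (holonomy p) => sik sil sjk sjl L sj si.
  move: (fjl p) (fil p) (fki p) (fkj p) => f1 f2 f3 f4.
  move: (inner_chord b i k p) (inner_chord b i l p) => Uik Uil.
  move: (inner_chord b j k p) (inner_chord b j l p) => Ujk Ujl.
  apply/eqP; rewrite -subr_eq0; apply/eqP.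
  transitivity (L / 2 * (Uik * Ujl - Uil * Ujk) *
    ((sik - sil + sik * sil) - (sjk - sjl + sjk * sjl))); first by field.
  by rewrite si sj subrr mulr0.
apply: poly_in_G_add; apply: poly_in_G_mul (poly_in_G_cst _ _) _;
  apply: poly_in_G_sub; apply: poly_in_G_mul => //; exact: pU.
Qed.

End ChordPolynomials.

Lemma poisson_bracketC (R : realType) n (b : 'I_n) (f g : coords R n -> R) p :
  poisson_bracket f g p = - poisson_bracket g f p.
Proof. by rewrite !(poisson_bracketE b) skew_formC. Qed.

(** Cutting the ring at the vertex i itself, the chord from i to j starts at
    position 0 and therefore avoids the cut. *)
Lemma poly_bracket_G_chord (R : realType) n (i j k l : 'I_n) : i != j ->
  poly_in_G (poisson_bracket (G i j) (G k l) : coords R n -> R).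
Proof.
move=> ij; have n0 := n_gt0 i.
have [a an jE] := vtx_surj i j; have [c cn ->] := vtx_surj i k.
have [d dn ->] := vtx_surj i l.
have a0 : (0 < a)%N.
  by rewrite lt0n; apply: contraNneq ij => a0; rewrite jE a0.
rewrite jE -[X in G X _]/(vtx i 0) G_inner //.
case: (ltngtP c d) => [cd|dc|<-].
- by rewrite G_inner //; exact: poly_bracket_inner_inner.
- by rewrite G_outer //; exact: poly_bracket_inner_outer.
- by rewrite G_diag; exact: poly_bracket_inner_loop.
Qed.

Theorem lemma4 (R : realType) (n : nat) (hn : (1 <= n)%N) (i j k l : 'I_n) :
  exists P : pair_poly R n, forall p : coords R n,
    poisson_bracket (G i j) (G k l) p = pair_eval (fun r s : 'I_n => G r s p) P.
Proof.
have [ij|nij] := eqVneq i j; last exact: poly_bracket_G_chord.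
have [kl|nkl] := eqVneq k l; last first.
  apply: (poly_in_G_ext (poisson_bracketC i (G i j) (G k l))).
  exact: poly_in_G_opp (poly_bracket_G_chord _ _ _ nkl).
subst j l; have [c cn ->] := vtx_surj i k.
rewrite -[X in G X X]/(vtx i 0) !G_diag.
exact: poly_bracket_loop_loop (n_gt0 i) cn.
Qed.
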